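(* Let $A\in SL(\mathbb{Z},2)$. Suppose that $A$ is diagonalizable over the field of complex numbers and that all its eigenvalues have modulus $1$. Then there exists a constant $C$ such that for all $n\in\mathbb{Z}$ and all $\mathbf{x}\in\mathbb{T}^2$, $$\|A^n\mathbf{x}\|_{\mathbb{T}^2}\le C\|\mathbf{x}\|_{\mathbb{T}^2}.$$ Thus the flow $\mathcal{X}=(\mathbb{T}^2,\ \mathbf{x}\mapsto A\mathbf{x}+\mathbf{b})$ is equicontinuous for every $\mathbf{b}\in\mathbb{T}^2$.
   Context: $\mathbb{T}^2=\mathbb{R}^2/\mathbb{Z}^2$, with $\|\mathbf{x}\|_{\mathbb{T}^2}=\inf_{\mathbf{m}\in\mathbb{Z}^2}\|\mathbf{x}-\mathbf{m}\|_{\mathbb{R}^2}$ (Euclidean norm) and metric $\|\mathbf{x}-\mathbf{y}\|_{\mathbb{T}^2}$. $SL(\mathbb{Z},2)$ denotes the set of $2\times2$ integer matrices $A$ with $\det A=\pm1$. A flow $(X,T)$ is a compact metric space $(X,d)$ with a continuous map $T:X\to X$; it is equicontinuous if for every $\epsilon>0$ there is $\delta>0$ such that $d(x,y)<\delta$ implies $d(T^nx,T^ny)<\epsilon$ for all $n\ge0$. *)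

(* Defs.v *)
From HB Require Import structures.
From mathcomp Require Import all_boot all_order all_algebra.
From mathcomp Require Import complex.
From mathcomp Require Import ring lra.
From mathcomp Require Import all_classical all_reals all_analysis.

Set Implicit Arguments.
Unset Strict Implicit.
Unset Printing Implicit Defensive.

Import Order.TTheory GRing.Theory Num.Theory.
Import numFieldNormedType.Exports.
Export Quotient.Exports.

Local Open Scope classical_set_scope.
Local Open Scope quotient_scope.
Local Open Scope ring_scope.

Record flow (R : realType) := Flow {
  flow_space : metricType R;
  flow_map : flow_space -> flow_space;
  flow_compact : compact [set: flow_space];
  flow_continuous : continuous flow_map }.

Definition equicontinuous_flow (R : realType) (X : flow R) : Prop :=
  forall eps : R, 0 < eps -> exists2 delta : R, 0 < delta &
    forall x y : flow_space X, mdist x y < delta ->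
    forall n : nat,
      mdist (iter n (@flow_map _ X) x) (iter n (@flow_map _ X) y) < eps.

(* Determinant -1 is allowed. *)
Definition SLZ2 : set 'M[int]_2 := [set A | \det A = 1 \/ \det A = -1].

Section Torus.
Variable R : realType.

(* The library's norm on matrices is the sup norm, hence this definition. *)
Definition enorm (v : 'cV[R]_2) : R := Num.sqrt (\sum_i v i 0 ^+ 2).

Definition Zlattice : pred 'cV[R]_2 := fun v => [forall i, v i 0 \in Num.int].

Fact Zlattice_zmod_closed : zmod_closed Zlattice.
Proof.
split=> [|u v /forallP hu /forallP hv]; apply/forallP => i; rewrite !mxE.
  exact: rpred0.
exact: rpredB.
Qed.

HB.instance Definition _ :=
  GRing.isZmodClosed.Build _ Zlattice Zlattice_zmod_closed.

Definition torus : Type :=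
  Quotient.quot (GRing.ZmodClosed.clone 'cV[R]_2 Zlattice _).

HB.instance Definition _ := Choice.on torus.
HB.instance Definition _ := GRing.Zmodule.on torus.

Definition toT (v : 'cV[R]_2) : torus := \pi_(Quotient.quot _) v.
Definition ofT (x : torus) : 'cV[R]_2 := repr x.

(* The infimum does not depend on the representative: see [toT_eq], [tnorm_le]
   and [tnorm_lt]. *)
Definition tnorm (x : torus) : R :=
  inf (range (fun m : 'cV[int]_2 => enorm (ofT x - map_mx intr m))).

(* [torus_actE] shows that this is the map induced by A on the quotient. *)
Definition torus_act (A : 'M[int]_2) (x : torus) : torus :=
  toT (map_mx intr A *m ofT x).

Lemma ofTK x : toT (ofT x) = x. Proof. exact: reprK. Qed.

Lemma toTB u v : toT (u - v) = toT u - toT v.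
Proof. exact: (raddfB (\pi_(Quotient.quot _))). Qed.

Lemma toTD u v : toT (u + v) = toT u + toT v.
Proof. exact: (raddfD (\pi_(Quotient.quot _))). Qed.

Lemma toT_eq u v : toT u = toT v <-> exists m, u - v = map_mx intr m.
Proof.
have -> : (toT u = toT v) <-> Zlattice (u - v).
  rewrite /toT; split => [/eqP|h].
    by rewrite -Quotient.idealrBE.
  by apply/eqP; rewrite -Quotient.idealrBE.
split=> [/forallP h|[m ->]]; last first.
  by apply/forallP => i; rewrite !mxE intr_int.
have /(_ _)/cid hm i : exists m : int, (u - v) i 0 = m%:~R.
  exact/intrP/h.
exists (\col_i projT1 (hm i)); apply/matrixP => i j.
rewrite ord1 [in RHS]mxE [in RHS]mxE.
exact: projT2 (hm i).
Qed.

Lemma toT_int m : toT (map_mx intr m) = 0.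
Proof.
transitivity (toT 0); last by rewrite -[0](subrr 0) toTB subrr.
by apply/toT_eq; exists m; rewrite subr0.
Qed.

Lemma torus_actE A v : torus_act A (toT v) = toT (map_mx intr A *m v).
Proof.
have /toT_eq [m hm] := ofTK (toT v).
by apply/toT_eq; exists (A *m m); rewrite -mulmxBr hm map_mxM.
Qed.

Lemma torus_actB A x y : torus_act A (x - y) = torus_act A x - torus_act A y.
Proof. by rewrite -(ofTK x) -(ofTK y) -toTB !torus_actE mulmxBr toTB. Qed.

Lemma torus_act1 x : torus_act 1 x = x.
Proof. by rewrite /torus_act map_scalar_mx rmorph1 mul1mx ofTK. Qed.

Lemma torus_actM A B x : torus_act (A * B) x = torus_act A (torus_act B x).
Proof. by rewrite [torus_act B x]/torus_act torus_actE mulmxA -map_mxM. Qed.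

Lemma enormE v : enorm v = Num.sqrt (v 0 0 ^+ 2 + v 1 0 ^+ 2).
Proof. by rewrite /enorm big_ord_recl big_ord1 (_ : lift _ _ = 1) //; exact/val_inj. Qed.

Lemma enorm_ge0 v : 0 <= enorm v. Proof. exact: sqrtr_ge0. Qed.

Lemma enorm0 : enorm 0 = 0.
Proof. by rewrite enormE !mxE expr0n addr0 sqrtr0. Qed.

Lemma enormN v : enorm (- v) = enorm v.
Proof. by rewrite !enormE !mxE !sqrrN. Qed.

Lemma enormD u v : enorm (u + v) <= enorm u + enorm v.
Proof.
rewrite -(@ler_pXn2r _ 2)// ?nnegrE ?addr_ge0 ?enorm_ge0//.
rewrite sqrrD !enormE !mxE !sqr_sqrtr ?addr_ge0 ?sqr_ge0//.
set a := u 0 0; set b := u 1 0; set c := v 0 0; set d := v 1 0.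
have ge0 (x y : R) : 0 <= x ^+ 2 + y ^+ 2 by rewrite addr_ge0 ?sqr_ge0.
have h : a * c + b * d <= Num.sqrt (a ^+ 2 + b ^+ 2) * Num.sqrt (c ^+ 2 + d ^+ 2).
  rewrite -sqrtrM ?ge0//; apply: (le_trans (ler_norm _)).
  rewrite -sqrtr_sqr ler_wsqrtr//.
  have := sqr_ge0 (a * d - b * c); nra.
have -> : (a + c) ^+ 2 + (b + d) ^+ 2
  = (a ^+ 2 + b ^+ 2) + (c ^+ 2 + d ^+ 2) + (a * c + b * d) *+ 2 by ring.
by rewrite [leRHS]addrAC lerD2l lerMn2r h orbT.
Qed.

Lemma normr_le_enorm (v : 'cV[R]_2) i : `|v i 0| <= enorm v.
Proof.
rewrite -sqrtr_sqr ler_wsqrtr// (bigD1 i)//= lerDl sumr_ge0// => j _.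
exact: sqr_ge0.
Qed.

Lemma enorm_le_sum v : enorm v <= \sum_i `|v i 0|.
Proof.
rewrite big_ord_recl big_ord1 (_ : lift _ _ = 1); last exact/val_inj.
rewrite enormE -(@ler_pXn2r _ 2)// ?nnegrE ?addr_ge0 ?sqrtr_ge0//.
rewrite sqr_sqrtr ?addr_ge0 ?sqr_ge0// sqrrD !real_normK ?num_real//.
by rewrite addrAC lerDl mulrn_wge0// mulr_ge0.
Qed.

Lemma enorm_has_inf x :
  has_inf (range (fun m : 'cV[int]_2 => enorm (ofT x - map_mx intr m))).
Proof.
split; first by eexists; exists 0.
by exists 0 => _ [m _ <-]; exact: enorm_ge0.
Qed.

Lemma tnorm_ge0 x : 0 <= tnorm x.
Proof.
apply: lb_le_inf; first by case: (enorm_has_inf x).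
by move=> _ [m _ <-]; exact: enorm_ge0.
Qed.

Lemma tnorm_le v : tnorm (toT v) <= enorm v.
Proof.
have /toT_eq [m hm] := ofTK (toT v).
apply: ge_inf; first by case: (enorm_has_inf (toT v)).
by exists m => //; rewrite -hm opprB addrC subrK.
Qed.

Lemma tnorm_lt x e : tnorm x < e -> exists2 v, toT v = x & enorm v < e.
Proof.
move=> /(inf_lt (proj1 (enorm_has_inf x)))[_ [m _ <-] h].
by exists (ofT x - map_mx intr m) => //; rewrite toTB ofTK toT_int subr0.
Qed.

Lemma tnormN x : tnorm (- x) = tnorm x.
Proof.
wlog suff: x / tnorm (- x) <= tnorm x.
  by move=> h; apply/eqP; rewrite eq_le h -{1}(opprK x) h.
apply/ler_addgt0Pr => e e0.
have [v <- /ltW ve] : exists2 v, toT v = x & enorm v < tnorm x + e.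
  by apply: tnorm_lt; rewrite ltrDl.
rewrite -(sub0r (toT v)) -(toT_int 0) -toTB (le_trans (tnorm_le _))//.
by rewrite map_mx0 sub0r enormN.
Qed.

Lemma tnormD x y : tnorm (x + y) <= tnorm x + tnorm y.
Proof.
apply/ler_addgt0Pr => e e0.
have [u hu /ltW ue] : exists2 v, toT v = x & enorm v < tnorm x + e / 2.
  by apply: tnorm_lt; rewrite ltrDl divr_gt0.
have [v hv /ltW ve] : exists2 v, toT v = y & enorm v < tnorm y + e / 2.
  by apply: tnorm_lt; rewrite ltrDl divr_gt0.
rewrite (splitr e) addrACA -{1}hu -{1}hv -toTD (le_trans (tnorm_le _))//.
by rewrite (le_trans (enormD _ _))// lerD.
Qed.

Lemma tnorm0 : tnorm 0 = 0.
Proof.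
apply/eqP; rewrite eq_le tnorm_ge0 andbT -(toT_int 0) map_mx0.
by rewrite (le_trans (tnorm_le _))// enorm0.
Qed.

Lemma enorm0_eq0 v : enorm v = 0 -> v = 0.
Proof.
move=> v0; apply/matrixP => i j; rewrite ord1 mxE; apply/normr0_eq0/eqP.
by rewrite eq_le normr_ge0 andbT -v0 normr_le_enorm.
Qed.

Lemma tnorm_eq0 x : tnorm x = 0 -> x = 0.
Proof.
move=> x0.
have half0 : 0 < 2^-1 :> R by rewrite invr_gt0.
have [u hu ue] : exists2 v, toT v = x & enorm v < 2^-1.
  by apply: tnorm_lt; rewrite x0.
have [/enorm0_eq0 u0|u0] := eqVneq (enorm u) 0.
  by rewrite -hu u0 -(map_mx0 intr) toT_int.
have [v hv ve] : exists2 v, toT v = x & enorm v < enorm u.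
  by apply: tnorm_lt; rewrite x0 lt_neqAle eq_sym u0 enorm_ge0.
have /toT_eq [m hm] : toT u = toT v by rewrite hu hv.
suff m0 : m = 0.
  move: hm; rewrite m0 map_mx0 => /eqP; rewrite subr_eq0 => /eqP uv.
  by move: ve; rewrite uv ltxx.
apply/matrixP => i j; rewrite ord1 mxE; apply/eqP/negPn/negP => mi.
have : 1 <= `|(u - v) i 0| by rewrite hm mxE norm_intr_ge1 ?intr_int ?intr_eq0.
rewrite leNgt => /negP; apply.
rewrite (le_lt_trans (normr_le_enorm _ _))//.
rewrite (le_lt_trans (enormD _ _))// enormN.
by rewrite [ltRHS](splitr 1) mul1r ltrD// (lt_trans ve).
Qed.

Definition tdist (x y : torus) : R := tnorm (x - y).

Fact tdistxx x : tdist x x = 0. Proof. by rewrite /tdist subrr tnorm0. Qed.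

Fact tdist_positivity x y : tdist x y = 0 -> x = y.
Proof. by move/tnorm_eq0/eqP; rewrite subr_eq0 => /eqP. Qed.

Fact tdist_sym x y : tdist x y = tdist y x.
Proof. by rewrite /tdist -tnormN opprB. Qed.

Fact tdist_triangle y x z : tdist x z <= tdist x y + tdist y z.
Proof. by rewrite /tdist -(subrKA y) tnormD. Qed.

HB.instance Definition _ := isMetric.Build R torus
  tdistxx tdist_positivity tdist_sym tdist_triangle.

Lemma mdist_torusE (x y : torus) : mdist x y = tnorm (x - y).
Proof. by []. Qed.

Lemma torus_compact : compact [set: torus].
Proof.
pose f (p : R * R) : torus := toT (\col_i if i == 0 then p.1 else p.2).
have fc : continuous f.
  move=> p; apply/cvg_ballP => e e0.
  have e20 : 0 < e / 2 by rewrite divr_gt0.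
  near=> q; rewrite ballEmdist/= mdist_torusE /f -toTB.
  have [q1 q2] : ball p (e / 2) q by near: q; exact: (nbhsx_ballx p _ e20).
  rewrite (le_lt_trans (tnorm_le _))// (le_lt_trans (enorm_le_sum _))//.
  by rewrite big_ord_recl big_ord1 !mxE/= [ltRHS]splitr ltrD.
have -> : [set: torus] = f @` (`[0, 1] `*` `[0, 1]).
  apply/esym/seteqP; split=> // x _.
  pose r i : R := ofT x i 0 - (Num.floor (ofT x i 0))%:~R.
  have r01 i : r i \in `[0, 1].
    rewrite in_itv/= /r subr_ge0 floor_le_tmp/= lerBlDl.
    have := floorD1_gt (ofT x i 0); rewrite intrD => /ltW; lra.
  exists (r 0, r 1); first by split; exact: r01.
  rewrite -[RHS]ofTK; apply/toT_eq.
  exists (\col_i - Num.floor (ofT x i 0)); apply/matrixP => i j.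
  rewrite ord1 !mxE rmorphN/=.
  have -> : (if i == 0 then r 0 else r 1) = r i.
    by case: i => -[|[|]]// hi; rewrite /=; congr r; exact/val_inj.
  by rewrite /r addrAC subrr add0r.
apply: continuous_compact; first exact/continuous_subspaceT.
by apply: compact_setX; exact: segment_compact.
Unshelve. all: by end_near. Qed.

Definition torus_affine (A : 'M[int]_2) (b : torus) (x : torus) : torus :=
  torus_act A x + b.

Lemma torus_affine_continuous A b : continuous (torus_affine A b).
Proof.
pose K : R := 1 + \sum_i \sum_j `|(A i j)%:~R|.
have K0 : 0 < K by rewrite ltr_pwDl// sumr_ge0// => i _; rewrite sumr_ge0.
have hK v : enorm (map_mx intr A *m v) <= K * enorm v.
  rewrite (le_trans (enorm_le_sum _))// mulrDl -[leLHS]add0r.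
  rewrite lerD ?mul1r ?enorm_ge0// mulr_suml ler_sum// => i _.
  rewrite mxE (le_trans (ler_norm_sum _ _ _))// mulr_suml ler_sum// => j _.
  by rewrite mxE normrM ler_wpM2l// normr_le_enorm.
move=> x; apply/(@cvg_ballP _ _ _ _ (nbhs_filter x)) => e e0.
have eK0 : 0 < e / K by rewrite divr_gt0.
near=> y; rewrite ballEmdist/= mdist_torusE /torus_affine.
have : ball x (e / K) y by near: y; exact: nbhsx_ballx.
rewrite ballEmdist/= mdist_torusE => /tnorm_lt[v hv ve].
rewrite opprD addrACA subrr addr0 -torus_actB -hv torus_actE.
rewrite (le_lt_trans (tnorm_le _))// (le_lt_trans (hK _))//.
by rewrite mulrC -ltr_pdivlMr.
Unshelve. all: by end_near. Qed.

Definition torus_flow (A : 'M[int]_2) (b : torus) : flow R :=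
  Flow torus_compact (@torus_affine_continuous A b).

End Torus.

(* Main.v *)
Require Import Defs.
From HB Require Import structures.
From mathcomp Require Import all_boot all_order all_algebra.
From mathcomp Require Import complex.
From mathcomp Require Import all_classical all_reals all_analysis.

Import Order.TTheory GRing.Theory Num.Theory.
Local Open Scope ring_scope.

(** Write P A = D P with P invertible and D complex diagonal.  The diagonal
    entries of D are eigenvalues of A, so they have modulus 1, and the same
    holds for every integer power D^n.  Hence the entries of
    A^n = P^-1 D^n P are bounded independently of n
    ([exprz_entries_bounded]), which bounds the Euclidean operator norm of A^n
    and then, by lifting points of the torus to nearly shortest vectors, its
    Lipschitz constant for the torus norm ([tnorm_torus_act_le]).  The n-th
    iterate of x |-> A x + b moves x - y to A^n (x - y), whatever b is, so a
    Lipschitz constant common to all the A^n gives equicontinuity. *)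

(** The basis P is a parameter, separate from M, because the bound on the
    entries of A^n is uniform in n only when a single P serves all powers. *)
Definition unimodular_diag {F : numFieldType} {n} (P M : 'M[F]_n) : Prop :=
  exists2 d : 'rV[F]_n, (forall i, `|d 0 i| = 1) & P *m M = diag_mx d *m P.

Section UnimodularDiag.
Variables (F : numFieldType) (n : nat).
Implicit Types P M N : 'M[F]_n.+1.

(** The rows of P are left eigenvectors of M, nonzero because P is invertible,
    so each diagonal entry of P M P^-1 is an eigenvalue. *)
Lemma diagonalizable_unimodular M : diagonalizable M ->
    (forall z, eigenvalue M z -> `|z| = 1) ->
  exists2 P, P \in unitmx & unimodular_diag P M.
Proof.
move=> [P Pu /similar_diagPex[d /(similarP Pu) PM]] ev1.
exists P => //; exists d => // i; apply: ev1.
apply/eigenvalueP; exists (row i P).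
  by rewrite -row_mul PM; apply/rowP => j; rewrite mxE mul_diag_mx !mxE.
apply/negP => /eqP Pi0.
have /(congr1 (fun v : 'rV_n.+1 => v 0 i)) : row i (P *m invmx P) = 0.
  by rewrite row_mul Pi0 mul0mx.
by rewrite mulmxV// !mxE eqxx => /eqP; rewrite oner_eq0.
Qed.

Lemma unimodular_diag1 P : unimodular_diag P 1.
Proof.
exists (const_mx 1) => [i|]; first by rewrite mxE normr1.
by rewrite diag_const_mx mul1mx mulmx1.
Qed.

Lemma unimodular_diagM P M N : unimodular_diag P M ->
  unimodular_diag P N -> unimodular_diag P (M * N).
Proof.
move=> [d d1 PM] [e e1 PN]; exists (\row_i (d 0 i * e 0 i)).
  by move=> i; rewrite mxE normrM d1 e1 mulr1.
by rewrite -mulmxE mulmxA PM -mulmxA PN mulmxA mulmx_diag.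
Qed.

(** Numbers of modulus 1 are closed under inversion; this is what puts the
    negative powers of A on the same footing as the positive ones. *)
Lemma unimodular_diagV P M : M \is a GRing.unit ->
  unimodular_diag P M -> unimodular_diag P M^-1.
Proof.
move=> Mu [d d1 PM]; exists (\row_i (d 0 i)^-1).
  by move=> i; rewrite mxE normfV d1 invr1.
rewrite -[P in RHS](mulmxK Mu) PM !mulmxA mulmx_diag.
rewrite (_ : \row_i _ = const_mx 1) ?diag_const_mx ?mul1mx//.
apply/rowP => i; rewrite !mxE mulVf// -normr_eq0 d1; exact: oner_neq0.
Qed.

Lemma unimodular_diagXz P M (k : int) : M \is a GRing.unit ->
  unimodular_diag P M -> unimodular_diag P (M ^ k).
Proof.
move=> Mu PM.
have PMX (m : nat) : unimodular_diag P (M ^+ m).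
  elim: m => [|m IHm]; first exact: unimodular_diag1.
  by rewrite exprS; exact: unimodular_diagM.
by case: k => m; [exact: PMX | apply: unimodular_diagV (PMX _); rewrite unitrX].
Qed.

(** The unimodular diagonal factor disappears under the norm in the expansion
    of M = P^-1 D P, which leaves a bound that depends on P alone. *)
Lemma unimodular_diag_entry_le P M i j : P \in unitmx ->
    unimodular_diag P M ->
  `|M i j| <= \sum_k `|invmx P i k| * `|P k j|.
Proof.
move=> Pu [d d1 PM].
rewrite -[M](mulKmx Pu) PM mxE (le_trans (ler_norm_sum _ _ _))//.
by apply: ler_sum => k _; rewrite mul_diag_mx mxE !normrM d1 mul1r.
Qed.

End UnimodularDiag.

(** The bound comes from a basis of complex eigenvectors. It is a nonnegative
    real element of R[i], so its real part bounds the integer entries in R. *)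
Lemma exprz_entries_bounded (R : rcfType) n (A : 'M[int]_n.+1) :
    A \is a GRing.unit ->
    diagonalizable (map_mx intr A : 'M[R[i]]_n.+1) ->
    (forall z : R[i],
      eigenvalue (map_mx intr A : 'M[R[i]]_n.+1) z -> `|z| = 1) ->
  exists K : 'M[R]_n.+1,
    forall (k : int) i j, `|((A ^ k) i j)%:~R| <= K i j.
Proof.
move=> Au Adiag Aev.
have [P Pu PA] := diagonalizable_unimodular _ _ _ Adiag Aev.
exists (\matrix_(i, j) complex.Re (\sum_k `|invmx P i k| * `|P k j|)).
move=> k i j; rewrite mxE.
have BE : map_mx intr (A ^ k) = (map_mx intr A : 'M[R[i]]_n.+1) ^ k.
  exact: (rmorphXz (map_mx intr)).
have Bu : (map_mx intr A : 'M[R[i]]_n.+1) \is a GRing.unit.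
  exact: (rmorph_unit (map_mx intr)).
have := unimodular_diag_entry_le _ _ _ _ i j Pu (unimodular_diagXz _ _ _ _ k Bu PA).
rewrite -BE mxE -(rmorph_int (real_complex R)) normc_def /=.
by rewrite expr0n addr0 sqrtr_sqr lecE => /andP[].
Qed.

Section TorusAction.
Variable R : realType.

(** If the torus norm of the image exceeded c |x|, some lift v of x would be so
    short that M v, a lift of the image, is shorter than the image's norm. *)
Lemma tnorm_torus_act_le (M : 'M[int]_2) (c : R) : 0 < c ->
    (forall v : 'cV[R]_2, enorm (map_mx intr M *m v) <= c * enorm v) ->
  forall x : torus R, tnorm (torus_act M x) <= c * tnorm x.
Proof.
move=> c0 Mc x; rewrite leNgt; apply/negP; rewrite mulrC -ltr_pdivlMr//.
move=> /tnorm_lt[v <-]; rewrite ltr_pdivlMr// mulrC torus_actE => cv.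
by have := lt_le_trans (le_lt_trans (Mc v) cv) (tnorm_le _); rewrite ltxx.
Qed.

Lemma enorm_mulmx_le (M : 'M[R]_2) (K : 'M[R]_2) (v : 'cV[R]_2) :
    (forall i j, `|M i j| <= K i j) ->
  enorm (M *m v) <= (\sum_i \sum_j K i j) * enorm v.
Proof.
move=> MK; rewrite (le_trans (enorm_le_sum _))// mulr_suml ler_sum// => i _.
rewrite mxE (le_trans (ler_norm_sum _ _ _))// mulr_suml ler_sum// => j _.
by rewrite normrM ler_pM// normr_le_enorm.
Qed.

(** The translation parts cancel in differences, so b leaves no trace. *)
Lemma iter_torus_affineB A (b x y : torus R) n :
  iter n (torus_affine A b) x - iter n (torus_affine A b) y
    = torus_act (A ^+ n) (x - y).
Proof.
elim: n => [|n IHn]; first by rewrite expr0 torus_act1.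
by rewrite !iterS opprD addrACA subrr addr0 -torus_actB IHn exprS torus_actM.
Qed.

Lemma torus_flow_equicontinuous A (b : torus R) (c : R) : 0 < c ->
    (forall (n : nat) (x : torus R),
      tnorm (torus_act (A ^+ n) x) <= c * tnorm x) ->
  equicontinuous_flow (torus_flow A b).
Proof.
move=> c0 Ac eps eps0; exists (eps / c); first by rewrite divr_gt0.
move=> x y xy n; rewrite mdist_torusE iter_torus_affineB.
by rewrite (le_lt_trans (Ac _ _))// mulrC -ltr_pdivlMr.
Qed.

End TorusAction.

Theorem proposition8 (R : realType) (A : 'M[int]_2)
  (hA : SLZ2 A)
  (hdiag : diagonalizable (map_mx intr A : 'M[R[i]]_2))
  (hev : forall z : R[i], eigenvalue (map_mx intr A : 'M[R[i]]_2) z -> `|z| = 1) :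
  (exists C : R, forall (n : int) (x : torus R),
     tnorm (torus_act (A ^ n) x) <= C * tnorm x) /\
  (forall b : torus R, equicontinuous_flow (torus_flow A b)).
Proof.
have Au : A \is a GRing.unit by rewrite unitmxE; case: hA => ->.
have [K AK] := exprz_entries_bounded _ _ _ Au hdiag hev.
have K0 : 0 <= \sum_i \sum_j K i j.
  apply: sumr_ge0 => i _; apply: sumr_ge0 => j _.
  exact: le_trans (normr_ge0 _) (AK 0 i j).
(* The added 1 makes the constant positive, so that eps / c can serve as the
   modulus of equicontinuity. *)
have c0 : 0 < 1 + \sum_i \sum_j K i j by rewrite ltr_pwDl.
have Ac (n : int) (x : torus R) :
    tnorm (torus_act (A ^ n) x) <= (1 + \sum_i \sum_j K i j) * tnorm x.
  apply: tnorm_torus_act_le => // v.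
  have MK i j : `|(map_mx intr (A ^ n) : 'M[R]_2) i j| <= K i j.
    by rewrite mxE; exact: AK.
  apply: (le_trans (enorm_mulmx_le _ _ _ _ MK)).
  by rewrite ler_wpM2r ?enorm_ge0// lerDr.
split; first by exists (1 + \sum_i \sum_j K i j).
by move=> b; apply: (torus_flow_equicontinuous _ _ _ _ c0) => n x; exact: Ac n x.
Qed.
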